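(* Let $\mathbf t=t_0t_1\cdots=01101001\cdots$ be the Thue--Morse word (fixed point of $0\mapsto01$, $1\mapsto10$), and for $i,m,n\ge0$ let $A(i,m,n)=(t_{i+k+\ell})_{0\le k<m,0\le\ell<n}$, with $|A(i,m,n)|_1$ its number of $1$ entries. There is a deterministic finite automaton with output having $92$ states that, on input $m$ and $n$ written in base $2$ (read in parallel, most significant digit first), outputs the balance $\max_{i,j\ge0}\big||A(i,m,n)|_1-|A(j,m,n)|_1\big|$ of the $m\times n$ rectangles. *)

(* Defs.v *)
From mathcomp Require Import all_boot all_algebra.

Set Implicit Arguments.
Unset Strict Implicit.
Unset Printing Implicit Defensive.

Definition mu (w : seq bool) : seq bool := flatten [seq [:: b; ~~ b] | b <- w].

(* The limit of the prefixes mu^k(0); since mu^n(0) has length 2^n > n, its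
   letter of index n is the letter t_n of the fixed point. *)
Definition tm (n : nat) : bool := nth false (iter n mu [:: false]) n.

Lemma size_mu w : size (mu w) = (size w).*2.
Proof. by elim: w => //= b w IHw; rewrite -/(mu w) IHw. Qed.

Lemma nth_mu w n : n < size w ->
  nth false (mu w) n.*2 = nth false w n
  /\ nth false (mu w) n.*2.+1 = ~~ nth false w n.
Proof. by elim: w n => [|b w IHw] [|n] //= /IHw. Qed.

Lemma size_iter_mu k : size (iter k mu [:: false]) = 2 ^ k.
Proof. by elim: k => //= k IHk; rewrite size_mu IHk expnS mul2n. Qed.

Lemma iter_mu_prefix k : exists w, iter k.+1 mu [:: false] = iter k mu [:: false] ++ w.
Proof.
elim: k => [|k [w IHk]]; first by exists [:: true].
by exists (mu w); rewrite iterS {1}IHk /mu map_cat flatten_cat.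
Qed.

Lemma tm_iter n k : n < 2 ^ k -> nth false (iter k mu [:: false]) n = tm n.
Proof.
have step j : n < 2 ^ j ->
    nth false (iter j.+1 mu [:: false]) n = nth false (iter j mu [:: false]) n.
  by move=> lt_nj; have [w ->] := iter_mu_prefix j; rewrite nth_cat size_iter_mu lt_nj.
have up d j : n < 2 ^ j ->
    nth false (iter (d + j) mu [:: false]) n = nth false (iter j mu [:: false]) n.
  move=> lt_nj; elim: d => // d IHd; rewrite addSn step ?IHd //.
  by apply: leq_trans lt_nj _; rewrite leq_exp2l // leq_addl.
move=> lt_nk; have lt_nn : n < 2 ^ n by exact: ltn_expl.
by rewrite -(up n k) // addnC up.
Qed.

Lemma tm_fixed_point n :
  [/\ tm 0 = false, tm n.*2 = tm n & tm n.*2.+1 = ~~ tm n].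
Proof.
have lt_nn : n < 2 ^ n by exact: ltn_expl.
have lt1 : n.*2.+1 < 2 ^ n.+1 by rewrite expnS mul2n -doubleS leq_double.
have [e0 e1] : tm n.*2 = tm n /\ tm n.*2.+1 = ~~ tm n.
  rewrite -(tm_iter (ltnW lt1)) -(tm_iter lt1).
  by rewrite iterS; apply: nth_mu; rewrite size_iter_mu.
by split.
Qed.

Definition tm_rect (i m n : nat) : 'M[bool]_(m, n) :=
  \matrix_(k < m, l < n) tm (i + k + l).

Definition ones m n (A : 'M[bool]_(m, n)) : nat :=
  #|[set p : 'I_m * 'I_n | A p.1 p.2]|.

Definition is_max (P : nat -> Prop) (b : nat) : Prop :=
  P b /\ forall c, P c -> c <= b.

(* Inside `|_ - _|%N the subtraction is that of int, not the truncated one. *)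
Definition is_balance (m n b : nat) : Prop :=
  is_max (fun c => exists i j : nat,
    c = `|ones (tm_rect i m n) - ones (tm_rect j m n)|%N) b.

Record dfao (Sigma Out : Type) := DFAO {
  state : finType;
  start : state;
  trans : state -> Sigma -> state;
  label : state -> Out
}.

Definition run Sigma Out (M : dfao Sigma Out) (w : seq Sigma) : Out :=
  label (foldl (@trans _ _ M) (start M) w).

(* Most significant digit first; leading zeros are allowed, as they are needed
   to bring two numerals read in parallel to a common length. *)
Definition val2 (w : seq bool) : nat := foldl (fun v (b : bool) => v.*2 + b) 0 w.

(* Main.v *)
(* Let s_j = (-1)^(t_j).  The sum of s_{i+k+l} over a rectangle is
   Q(i+m+n) - Q(i+m) - Q(i+n) + Q(i), where Q is the second primitive of s, and
   Q(j) is 0 or s_{j/4} according to j mod 4.  As t has the complement of each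
   of its factors, the balance is the largest absolute value of this sum over i.
   It only depends on the last two digits of i, m, n and, for the remaining
   quotients, on the "view" of i: seven letters of t relative to t_i, near i+m,
   i+n and i+m+n.  Appending a digit to i, m and n acts on the view.  So an
   automaton reading m and n is correct as soon as each of its states q carries
   - a set of views containing the view of every i, stable under the transitions
     and giving sums at most the announced balance (upper bound);
   - a family of sets of views ("clauses"), each containing the view of some i,
     such that the preimage of a clause of the next state contains a clause of
     q, and so does the set of views reaching the announced balance after two
     more digits (lower bound).
   Both certificates are finite and are checked by computation. *)
Require Import Defs.
From mathcomp Require Import all_boot all_algebra.
From mathcomp Require Import zify ring.
From Stdlib Require BinNat.

Set Implicit Arguments.
Unset Strict Implicit.
Unset Printing Implicit Defensive.

Import GRing.Theory.

Definition sgn (b : bool) : int := ((-1) ^+ b)%R.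

(** * Rectangle sums of signs and the balance *)

Definition rect_sum (i m n : nat) : int :=
  (\sum_(k < m) \sum_(l < n) sgn (tm (i + k + l)))%R.

(* The second primitive of the sign sequence of t is again read off t:
   its values on 4j, 4j + 1, 4j + 2, 4j + 3 are 0, 0, s_j, s_j. *)
Definition prim2 (j : nat) : int := if odd j./2 then sgn (tm j./2./2) else 0%R.

Lemma tm_double_add j k : tm (j.*2 + k) = tm (j + k./2) (+) odd k.
Proof.
have [_ e0 e1] := tm_fixed_point (j + k./2).
rewrite -{1}(odd_double_half k) addnCA -doubleD; case: (odd k).
  by rewrite add1n e1 addbT.
by rewrite add0n e0 addbF.
Qed.

Lemma prim2_add j r :
  prim2 (4 * j + r) = (if odd r./2 then sgn (tm (j + r./2./2)) else 0)%R.
Proof.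
rewrite /prim2; have -> : (4 * j + r)./2 = j.*2 + r./2 by lia.
by rewrite oddD odd_double halfD odd_double doubleK.
Qed.

(** A block of four signs is [s, -s, -s, s]. It sums to 0 and its partial sums sum to 0, so both
    primitives restart from 0 at multiples of 4. *)
Lemma prim2_diff j :
  (prim2 j.+2 - prim2 j.+1 - (prim2 j.+1 - prim2 j) = sgn (tm j))%R.
Proof.
rewrite (divn_eq j 4) mulnC -!addnS !prim2_add.
have -> : 4 * (j %/ 4) = ((j %/ 4).*2).*2 by lia.
rewrite !tm_double_add.
case: (j %% 4) (ltn_pmod j (isT : 0 < 4)) => [|[|[|[|//]]]] _ /=;
  by rewrite ?addn0 ?addbF; case: (tm _).
Qed.

Lemma rect_sumE i m n :
  (rect_sum i m n = prim2 (i + m + n) - prim2 (i + m) - prim2 (i + n) + prim2 i)%R.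
Proof.
have row j : (\sum_(l < n) sgn (tm (j + l)) =
    (prim2 (j + n).+1 - prim2 (j + n)) - (prim2 j.+1 - prim2 j))%R.
  elim: n => [|p IHp]; first by rewrite big_ord0 addn0 subrr.
  by rewrite big_ord_recr /= IHp -prim2_diff addnS; ring.
rewrite /rect_sum; elim: m => [|p IHp]; first by rewrite big_ord0 addn0; ring.
rewrite big_ord_recr /= IHp row !addnS !addSn; ring.
Qed.

Lemma ones_rect_sum i m n :
  (Posz (ones (tm_rect i m n)) *+ 2 = Posz (m * n)%N - rect_sum i m n)%R.
Proof.
have -> : ones (tm_rect i m n) = \sum_(k < m) \sum_(l < n) tm (i + k + l).
  rewrite /ones -sum1dep_card pair_bigA big_mkcond /=.
  by apply: eq_bigr => p _; rewrite mxE; case: (tm _).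
have -> : m * n = \sum_(k < m) \sum_(l < n) 1.
  by rewrite !sum_nat_const !card_ord muln1.
have sgnE b : sgn b = (1 - (Posz b) *+ 2)%R by case: b.
have PoszS p (F : 'I_p -> nat) : Posz (\sum_(k < p) F k) = (\sum_(k < p) Posz (F k))%R.
  exact: (big_morph Posz PoszD).
rewrite !PoszS -sumrB -sumrMnl; apply: eq_bigr => k _.
rewrite !PoszS -sumrB -sumrMnl; apply: eq_bigr => l _.
by rewrite sgnE; ring.
Qed.

Lemma tm_compl k x : x < 2 ^ k -> tm (2 ^ k + x) = ~~ tm x.
Proof.
elim: k x => [|k IHk] x.
  rewrite ltnS leqn0 => /eqP ->.
  by have [_ _] := tm_fixed_point 0.
rewrite expnS mul2n => ltx.
have lth : x./2 < 2 ^ k by lia.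
have e := tm_double_add 0 x; rewrite add0n add0n in e.
by rewrite tm_double_add IHk // addNb -e.
Qed.

Lemma rect_sum_opp i m n : exists j, rect_sum j m n = (- rect_sum i m n)%R.
Proof.
(* The power of two exceeds every index met in the rectangle, so the shift complements all its
   letters. *)
exists (2 ^ (i + m + n) + i); rewrite /rect_sum -sumrN.
apply: eq_bigr => k _; rewrite -sumrN; apply: eq_bigr => l _.
have ltr : i + k + l < 2 ^ (i + m + n).
  apply: leq_ltn_trans (ltn_expl _ (isT : 1 < 2)).
  by rewrite !leq_add // ltnW.
have -> : 2 ^ (i + m + n) + i + k + l = 2 ^ (i + m + n) + (i + k + l).
  by rewrite !addnA.
by rewrite tm_compl //; case: (tm _).
Qed.

(** Differences of counts are, up to sign, half the differences of sums; opposite sums attain the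
    bound. *)
Lemma balance_rect_sum m n b :
  (forall i, `|rect_sum i m n|%N <= b) ->
  (exists i, `|rect_sum i m n|%N = b) -> is_balance m n b.
Proof.
move=> ub [i ib]; split.
  have [j ej] := rect_sum_opp i m n; exists i, j.
  by have := ones_rect_sum i m n; have := ones_rect_sum j m n; lia.
move=> c [j [k ->]].
have := ones_rect_sum j m n; have := ones_rect_sum k m n.
by have := ub j; have := ub k; lia.
Qed.

(** Two of the three letters form a block [01] or [10]. This limits the views of [(0, 0)]. *)
Lemma tm_cube_free i : ~~ ((tm i == tm i.+1) && (tm i == tm i.+2)).
Proof.
have dif j : tm j.*2.+1 = ~~ tm j.*2 by have [_ -> ->] := tm_fixed_point j.
rewrite -(odd_double_half i); case: (odd i).
  by rewrite add1n -doubleS (dif _.+1); case: (tm _.*2.+1); case: (tm _).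
by rewrite add0n dif; case: (tm _.*2).
Qed.

(** * Views and the action of digits on them *)

(* Packed into binary numbers for the speed of the certificate checks. *)
Definition view : Type := BinNums.N.

Definition bit : view -> nat -> bool := BinNat.N.testbit_nat.

Definition pack : seq bool -> view :=
  foldr (fun b : bool => if b then BinNat.N.succ_double else BinNat.N.double)
    BinNums.N0.

Lemma bit_pack s k : bit (pack s) k = nth false s k.
Proof.
elim: s k => [|b s IHs] [|k] //=; rewrite -?IHs; move: (pack s);
  by case: b => [] [|[]].
Qed.

(* The relative letters of t at the positions which matter for the pair
   (m, n): the lower digits of i, m, n produce a carry of at most 1 in
   i + m and i + n, and of at most 2 in i + m + n. *)
Definition view_at (i m n : nat) : view :=
  pack [seq tm i (+) tm (i + x) |
     x <- [:: m; m + 1; n; n + 1; m + n; m + n + 1; m + n + 2]].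

(** The offset [c] is 0, 2 or 4, for the letters near [i + m], [i + n], [i + m + n]; the final [f]
    makes them relative to the letter of index [2i + f]. *)
Definition view_step (v : view) (a : bool * bool) (f : bool) : view :=
  let g c k := bit v (c + k./2) (+) odd k (+) f in
  pack
    [:: g 0 (a.1 + f); g 0 (a.1 + f + 1); g 2 (a.2 + f); g 2 (a.2 + f + 1);
        g 4 (a.1 + a.2 + f); g 4 (a.1 + a.2 + f + 1); g 4 (a.1 + a.2 + f + 2)].

(** The sign of [tm i] is factored out, as the absolute value ignores it; hence the 1 in [h0]. *)
Definition view_value (v : view) (d e f : nat) : nat :=
  let h c k := (if odd k./2 then sgn (bit v (c + k./2./2)) else 0)%R in
  let h0 := (if odd f./2 then 1 else 0)%R in
  absz (h 4 (d + e + f) - h 0 (d + f) - h 2 (e + f) + h0)%R.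

Lemma bit_view_at i m n (v := view_at i m n) :
  [/\ forall c, c < 2 -> bit v (0 + c) = tm i (+) tm (i + m + c),
      forall c, c < 2 -> bit v (2 + c) = tm i (+) tm (i + n + c) &
      forall c, c < 3 -> bit v (4 + c) = tm i (+) tm (i + m + n + c)].
Proof.
split=> c; rewrite /v bit_pack -!addnA.
- by case: c => [|[|]] //= _; rewrite addn0.
- by case: c => [|[|]] //= _; rewrite addn0.
- by case: c => [|[|[|]]] //= _; rewrite !addn0.
Qed.

Lemma view_stepE i m n a f :
  view_step (view_at i m n) a f = view_at (i.*2 + f) (m.*2 + a.1) (n.*2 + a.2).
Proof.
have rel x k y : y = x.*2 + k ->
    tm (i.*2 + f) (+) tm y = tm i (+) tm (x + k./2) (+) odd k (+) f.
  move=> ->; rewrite !tm_double_add oddb.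
  have -> : f./2 = 0 by case: f.
  by rewrite addn0; case: (tm i); case: (tm _); case: (odd k); case: f.
have [b0 b2 b4] := bit_view_at i m n.
case: a => d e; rewrite /view_step [RHS]/view_at /fst /snd.
rewrite !b4 ?b2 ?b0; try by case: (d) (e) (f) => [] [] [].
congr (pack [:: _; _; _; _; _; _; _]); symmetry; apply: rel;
  by move: (nat_of_bool d) (nat_of_bool e) (nat_of_bool f); lia.
Qed.

Lemma view_valueE i m n d e f : d < 4 -> e < 4 -> f < 4 ->
  `|rect_sum (4 * i + f) (4 * m + d) (4 * n + e)|%N = view_value (view_at i m n) d e f.
Proof.
move=> ltd lte ltf; have [b0 b2 b4] := bit_view_at i m n.
have sgnD x y : sgn y = (sgn x * sgn (x (+) y))%R by case: x y => [] [].
rewrite /view_value b4 ?b2 ?b0; try lia.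
rewrite rect_sumE.
have -> : 4 * i + f + (4 * m + d) + (4 * n + e) = 4 * (i + m + n) + (d + e + f) by lia.
have -> : 4 * i + f + (4 * m + d) = 4 * (i + m) + (d + f) by lia.
have -> : 4 * i + f + (4 * n + e) = 4 * (i + n) + (e + f) by lia.
rewrite !prim2_add.
have -> : i + f./2./2 = i by lia.
rewrite (sgnD (tm i) (tm (i + m + n + _))) (sgnD (tm i) (tm (i + m + _))).
rewrite (sgnD (tm i) (tm (i + n + _))).
move: (sgn (tm i (+) tm (i + m + n + _))) (sgn (tm i (+) tm (i + m + _))).
move: (sgn (tm i (+) tm (i + n + _))) => u2 u3 u1.
by case: (tm i); do 4 case: ifP => _; rewrite /sgn ?expr1 ?expr0; lia.
Qed.

(** * The automaton and its certificates *)

(* The minimal automaton, obtained from the determinization of the action of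
   digits on views: one row per state, one column per pair of digits, in the
   order of [letters]. *)
Definition table : seq (seq nat) := [::
  [:: 0; 1; 2; 3]; [:: 4; 5; 6; 7]; [:: 8; 9; 10; 11]; [:: 12; 13; 14; 15];
  [:: 16; 17; 18; 19]; [:: 17; 20; 21; 22]; [:: 23; 24; 25; 26];
  [:: 27; 28; 29; 30]; [:: 31; 32; 33; 34]; [:: 23; 35; 36; 37];
  [:: 33; 38; 39; 22]; [:: 40; 41; 42; 30]; [:: 43; 44; 45; 46];
  [:: 47; 44; 48; 49]; [:: 50; 51; 45; 52]; [:: 53; 51; 48; 54];
  [:: 55; 17; 56; 22]; [:: 17; 17; 57; 22]; [:: 58; 59; 45; 52];
  [:: 47; 59; 48; 60]; [:: 17; 61; 57; 62]; [:: 47; 59; 63; 64];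
  [:: 58; 59; 57; 64]; [:: 65; 66; 67; 68]; [:: 58; 69; 70; 64];
  [:: 58; 71; 25; 68]; [:: 72; 73; 57; 64]; [:: 74; 59; 70; 64];
  [:: 58; 44; 70; 64]; [:: 72; 73; 45; 64]; [:: 72; 28; 42; 30];
  [:: 75; 76; 33; 22]; [:: 58; 44; 57; 49]; [:: 33; 59; 33; 22];
  [:: 50; 51; 57; 77]; [:: 58; 35; 71; 68]; [:: 58; 73; 78; 64];
  [:: 72; 59; 70; 64]; [:: 50; 79; 57; 64]; [:: 33; 59; 80; 62];
  [:: 81; 73; 57; 64]; [:: 72; 44; 70; 64]; [:: 58; 73; 45; 64];
  [:: 82; 83; 84; 64]; [:: 58; 44; 57; 64]; [:: 58; 59; 45; 64];
  [:: 58; 73; 70; 64]; [:: 85; 44; 86; 64]; [:: 72; 59; 45; 64];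
  [:: 58; 59; 70; 64]; [:: 85; 87; 45; 64]; [:: 72; 44; 57; 64];
  [:: 58; 73; 57; 64]; [:: 85; 87; 86; 64]; [:: 58; 32; 18; 15];
  [:: 16; 17; 57; 22]; [:: 58; 28; 67; 68]; [:: 58; 59; 45; 64];
  [:: 85; 44; 45; 64]; [:: 58; 44; 57; 64]; [:: 58; 73; 57; 88];
  [:: 17; 20; 57; 22]; [:: 58; 28; 42; 68]; [:: 72; 59; 21; 64];
  [:: 58; 59; 57; 64]; [:: 65; 66; 67; 68]; [:: 58; 44; 70; 64];
  [:: 58; 73; 45; 64]; [:: 72; 59; 57; 64]; [:: 58; 89; 57; 52];
  [:: 58; 59; 70; 64]; [:: 58; 73; 70; 64]; [:: 72; 59; 57; 64];
  [:: 58; 73; 57; 64]; [:: 27; 59; 48; 64]; [:: 31; 59; 33; 22];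
  [:: 58; 66; 42; 68]; [:: 58; 59; 70; 90]; [:: 58; 59; 91; 49];
  [:: 72; 38; 57; 64]; [:: 33; 59; 39; 22]; [:: 40; 51; 57; 64];
  [:: 43; 44; 45; 46]; [:: 47; 44; 48; 64]; [:: 50; 51; 45; 64];
  [:: 85; 44; 45; 64]; [:: 58; 59; 70; 64]; [:: 58; 73; 57; 64];
  [:: 58; 59; 57; 60]; [:: 58; 69; 57; 64]; [:: 58; 59; 57; 77];
  [:: 58; 59; 78; 64]].

Definition balances : seq nat := [::
  0; 0; 0; 1; 0; 0; 2; 1; 0; 2; 0; 1; 2; 2; 2; 3; 0; 0; 2; 1; 0; 2; 1; 2; 2;
  4; 3; 2; 2; 2; 3; 0; 2; 0; 1; 4; 2; 3; 2; 0; 2; 2; 2; 4; 4; 4; 3; 2; 2; 3;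
  2; 2; 3; 2; 3; 0; 2; 2; 2; 2; 3; 0; 1; 2; 3; 4; 4; 4; 3; 2; 2; 2; 2; 2; 2;
  0; 2; 3; 2; 2; 0; 2; 4; 4; 4; 4; 4; 4; 3; 2; 3; 2].

Definition letters : seq (bool * bool) :=
  [:: (false, false); (false, true); (true, false); (true, true)].

Definition next (q : nat) (a : bool * bool) : nat :=
  nth 0 (nth [::] table q) (a.1.*2 + a.2).

Definition views_step (us : seq (seq view)) : seq (seq view) :=
  foldl (fun us q => foldl (fun us a =>
      set_nth [::] us (next q a)
        (undup (nth [::] us (next q a) ++
           [seq view_step v a f | v <- nth [::] us q, f <- [:: false; true]])))
    us letters) us (iota 0 92).

(* Saturation from the views of (0, 0): twelve rounds reach the fixed point. *)
Definition views : seq (seq view) := Eval vm_compute in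
  iter 12 views_step
    (set_nth [::] (nseq 92 [::]) 0 (undup [seq view_at i 0 0 | i <- iota 0 6])).

Definition last_value (v : view) (a b : bool * bool) (f : nat) : nat :=
  view_value v (a.1.*2 + b.1) (a.2.*2 + b.2) f.

Definition final (q : nat) (a b : bool * bool) : nat :=
  nth 0 balances (next (next q a) b).

Definition views_ok : bool :=
  all (fun q => all (fun v => all (fun a =>
      all (fun f => view_step v a f \in nth [::] views (next q a)) [:: false; true]
      && all (fun b => all (fun f => last_value v a b f <= final q a b) (iota 0 4))
           letters)
    letters) (nth [::] views q)) (iota 0 92).

Definition hits (v : view) (a : bool * bool) (c : seq view) : bool :=
  has (fun f => view_step v a f \in c) [:: false; true].

(* In a clause, the order of [views] is kept, hence inclusion is [subseq]. *)
Definition goals (q : nat) : seq (seq view) :=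
  [seq [seq v <- nth [::] views q |
         has (fun f => final q a b <= last_value v a b f) (iota 0 4)] |
     a <- letters, b <- letters].

Definition preimages (css : seq (seq (seq view))) (q : nat) :=
  [seq [seq v <- nth [::] views q | hits v a c] |
     a <- letters, c <- nth [::] css (next q a)].

Definition covers (cs : seq (seq view)) (c : seq view) : bool :=
  has (fun c' => subseq c' c) cs.

Definition insert_min (cs : seq (seq view)) (c : seq view) :=
  if covers cs c then cs else c :: [seq c' <- cs | ~~ subseq c c'].

(* The inclusion-minimal clauses; four rounds reach the fixed point. *)
Definition clauses : seq (seq (seq view)) := Eval vm_compute in
  iter 4
    (fun css => [seq foldl insert_min (nth [::] css q) (preimages css q) |
                   q <- iota 0 92])
    [seq foldl insert_min [::] (goals q) | q <- iota 0 92].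

Definition clauses_ok : bool :=
  all (fun c => has (fun i => view_at i 0 0 \in c) (iota 0 6)) (nth [::] clauses 0) &&
  all (fun q => all (covers (nth [::] clauses q)) (goals q ++ preimages clauses q))
    (iota 0 92).

Lemma views_okT : views_ok.
Proof. by vm_compute. Qed.

Lemma clauses_okT : clauses_ok.
Proof. by vm_compute. Qed.

(** * Soundness of the certificates *)

Lemma val2_unzip_rcons (w : seq (bool * bool)) a :
  (val2 (unzip1 (rcons w a)) = (val2 (unzip1 w)).*2 + a.1) *
  (val2 (unzip2 (rcons w a)) = (val2 (unzip2 w)).*2 + a.2).
Proof. by rewrite /unzip1 /unzip2 !map_rcons /val2 !foldl_rcons. Qed.

Definition state_after (w : seq (bool * bool)) : nat := foldl next 0 w.

Lemma next_lt q a : next q a < 92.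
Proof.
have /allP lt92 : all (all (fun r => r < 92)) table by [].
rewrite /next; case: (ltnP q (size table)) => [ltq | leq]; last first.
  by rewrite [nth [::] _ _]nth_default // nth_nil.
have /allP lta := lt92 _ (mem_nth [::] ltq).
set row := nth _ _ _ in lta *.
case: (ltnP (a.1.*2 + a.2) (size row)) => [/(mem_nth 0)/lta // | ler].
by rewrite nth_default.
Qed.

Lemma state_after_mem w : state_after w \in iota 0 92.
Proof.
rewrite mem_iota; case/lastP: w => // w a.
by rewrite /state_after foldl_rcons next_lt.
Qed.

Lemma mem_letters a : a \in letters.
Proof. by case: a => [[] []]. Qed.

Lemma mem_bits f : f \in [:: false; true].
Proof. by case: f. Qed.

Lemma view_at_reach w i :
  view_at i (val2 (unzip1 w)) (val2 (unzip2 w)) \in nth [::] views (state_after w).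
Proof.
elim/last_ind: w i => [|w a IHw] i.
  rewrite -[_ \in _]/(view_at i 0 0 \in nth [::] views 0).
  rewrite /view_at /map !add0n addn0 addn1 addn2.
  have := tm_cube_free i.
  by case: (tm i); case: (tm i.+1); case: (tm i.+2); vm_compute.
rewrite !val2_unzip_rcons /state_after foldl_rcons -/(state_after w).
rewrite -(odd_double_half i) addnC -view_stepE.
have /allP/(_ _ (state_after_mem w))/allP/(_ _ (IHw i./2)) := views_okT.
by move=> /allP/(_ _ (mem_letters a))/andP[/allP/(_ _ (mem_bits (odd i)))].
Qed.

(** The witness grows digit by digit: some [i] hits a clause inside the preimage of [c], and [hits]
    gives the digit to append. *)
Lemma clause_hit w c : c \in nth [::] clauses (state_after w) ->
  exists i, view_at i (val2 (unzip1 w)) (val2 (unzip2 w)) \in c.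
Proof.
have /andP[/allP ok0 /allP okS] := clauses_okT.
elim/last_ind: w c => [|w a IHw] c.
  by move=> /ok0/hasP[i _ ic]; exists i.
rewrite !val2_unzip_rcons /state_after foldl_rcons -/(state_after w) => cP.
have /allP/(_ [seq v <- nth [::] views (state_after w) | hits v a c]) :=
  okS _ (state_after_mem w).
rewrite mem_cat orbC.
case/(_ _)/hasP; first by rewrite (allpairs_f_dep _ (mem_letters a) cP).
move=> c' /IHw[i ic'] /mem_subseq/(_ _ ic'); rewrite mem_filter.
by case/andP=> /hasP[f _ fc] _; exists (i.*2 + f); rewrite -view_stepE.
Qed.

Lemma balance_rcons w a b :
  is_balance (val2 (unzip1 (rcons (rcons w a) b)))
    (val2 (unzip2 (rcons (rcons w a) b))) (final (state_after w) a b).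
Proof.
set q := state_after w; rewrite !val2_unzip_rcons.
set m := val2 (unzip1 w); set n := val2 (unzip2 w).
have valE i f : f < 4 ->
    `|rect_sum (4 * i + f) ((m.*2 + a.1).*2 + b.1) ((n.*2 + a.2).*2 + b.2)|%N =
    last_value (view_at i m n) a b f.
  move=> ltf; rewrite /last_value -view_valueE //.
  - by congr (absz (rect_sum _ _ _)); rewrite doubleD addnA -mul2n -mul2n mulnA.
  - by case: a b => [[] ?] [[] ?].
  by case: a b => [? []] [? []].
have ub i : `|rect_sum i ((m.*2 + a.1).*2 + b.1) ((n.*2 + a.2).*2 + b.2)|%N
    <= final q a b.
  have ltf := ltn_pmod i (isT : 0 < 4).
  rewrite (divn_eq i 4) mulnC valE //.
  have /allP/(_ _ (state_after_mem w))/allP/(_ _ (view_at_reach w (i %/ 4))) :=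
    views_okT.
  move=> /allP/(_ _ (mem_letters a))/andP[_ /allP/(_ _ (mem_letters b))/allP].
  by apply; rewrite mem_iota.
apply: balance_rect_sum => //.
have /andP[_ /allP/(_ _ (state_after_mem w))/allP] := clauses_okT.
(* This set contains a clause, so some [i] has its view in it; [f] then supplies the last two digits
   of the witness. *)
move=> /(_ [seq v <- nth [::] views q |
             has (fun f => final q a b <= last_value v a b f) (iota 0 4)]).
rewrite mem_cat.
case/(_ _)/hasP; first by rewrite (allpairs_f_dep _ (mem_letters a) (mem_letters b)).
move=> c /clause_hit[i ic] /mem_subseq/(_ _ ic); rewrite mem_filter.
case/andP=> /hasP[f]; rewrite mem_iota => /= ltf le_val _.
by exists (4 * i + f); apply/eqP; rewrite eqn_leq ub valE.
Qed.

Lemma balance_state_after w :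
  is_balance (val2 (unzip1 w)) (val2 (unzip2 w)) (nth 0 balances (state_after w)).
Proof.
(* Two leading zeros change nothing, and provide the last two digits. *)
have <- : state_after [:: (false, false), (false, false) & w] = state_after w by [].
rewrite -[val2 (unzip1 w)]/(val2 (unzip1 [:: (false, false), (false, false) & w])).
rewrite -[val2 (unzip2 w)]/(val2 (unzip2 [:: (false, false), (false, false) & w])).
case/lastP: (_ :: _) (isT : 1 < size [:: (false, false), (false, false) & w]) => //.
move=> u b; rewrite size_rcons; case/lastP: u => // u a _.
have := balance_rcons u a b; rewrite /final /state_after !foldl_rcons.
exact.
Qed.

Theorem theorem12 :
  exists M : dfao (bool * bool) nat,
    #|state M| = 92 /\
    forall (m n : nat) (w : seq (bool * bool)),
      val2 (unzip1 w) = m -> val2 (unzip2 w) = n ->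
      is_balance m n (run M w).
Proof.
pose trans_ord (q : 'I_92) a : 'I_92 := inord (next q a).
exists (DFAO ord0 trans_ord (fun q : 'I_92 => nth 0 balances q)).
split=> [|m n w <- <-]; first exact: card_ord.
suff -> : run (DFAO ord0 trans_ord (fun q : 'I_92 => nth 0 balances q)) w =
    nth 0 balances (state_after w) by exact: balance_state_after.
rewrite /run /=; congr nth.
elim/last_ind: w => // w a IHw.
by rewrite /state_after !foldl_rcons /= inordK ?next_lt // IHw.
Qed.
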